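(* Let $\tilde\omega$ be the Kähler metric on $\mathbb C^2$ defined by the Kähler potential $\Phi(z,w)=\exp\left(\frac14|z|^2-\frac{\sqrt{-1}}4(w-\bar w)\right)$. Then $(\mathbb C^2,\tilde\omega)$ admits a global full Kähler immersion into $\ell^2(\mathbb C)$.
   Context: A Kähler potential $\Phi$ for $\tilde\omega$ means $\tilde\omega=\frac{\sqrt{-1}}2\partial\bar\partial\Phi$. A global Kähler immersion of $(\mathbb C^2,\tilde\omega)$ into $\ell^2(\mathbb C)$ is a holomorphic map $F\colon\mathbb C^2\to\ell^2(\mathbb C)$ with $F^*\omega_0=\tilde\omega$, where $\omega_0=\frac{\sqrt{-1}}2\partial\bar\partial\|z\|^2$ is the flat Kähler form. It is full if its image is not contained in any proper totally geodesic complex submanifold of $\ell^2(\mathbb C)$. *)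

(* Defs.v *)
From HB Require Import structures.
From mathcomp Require Import all_boot all_order all_algebra.
From mathcomp Require Import all_classical all_reals all_analysis.
From mathcomp Require Import complex ring.

Set Implicit Arguments.
Unset Strict Implicit.
Unset Printing Implicit Defensive.

Import Order.TTheory GRing.Theory Num.Theory numFieldNormedType.Exports.
Import ComplexField.Normc.

Local Open Scope classical_set_scope.
Local Open Scope ring_scope.
Local Open Scope complex_scope.

(* The regular module R[i]^o carries the normed topology of R[i]. *)
Notation complex1 R := (R[i]^o).
Notation complex2 R := (R[i]^o * R[i]^o)%type.

Section SquareSummable.
Variable R : realType.
Implicit Types x y : nat -> complex1 R.

Definition square_summable : {pred nat -> complex1 R} :=
  fun x => `[< cvgn (series (fun n => normc (x n) ^+ 2)) >].

Definition sqnorm x : R := limn (series (fun n => normc (x n) ^+ 2)).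

Lemma square_summableP x :
  reflect (cvgn (series (fun n => normc (x n) ^+ 2))) (x \in square_summable).
Proof. exact: asboolP. Qed.

Lemma normc_sq_ge0 x n : 0 <= normc (x n) ^+ 2.
Proof. exact: sqr_ge0. Qed.

Lemma series_sq_nondecreasing x :
  {homo series (fun n => normc (x n) ^+ 2) : n m / (n <= m)%N >-> n <= m}.
Proof. by apply/nondecreasing_series => n _ _; exact: normc_sq_ge0. Qed.

Lemma le_sqnorm x n : x \in square_summable ->
  series (fun n => normc (x n) ^+ 2) n <= sqnorm x.
Proof.
move=> /square_summableP cx.
by apply: nondecreasing_cvgn_le => //; exact: series_sq_nondecreasing.
Qed.

Lemma sqnorm_ge0 x : x \in square_summable -> 0 <= sqnorm x.
Proof. by move=> /(@le_sqnorm x 0); rewrite /series /= big_geq. Qed.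

Lemma sqnorm_le x (B : R) :
  (forall n, series (fun n => normc (x n) ^+ 2) n <= B) ->
  x \in square_summable /\ sqnorm x <= B.
Proof.
move=> xB; have cx : x \in square_summable.
  apply/square_summableP; apply: nondecreasing_is_cvgn.
    exact: series_sq_nondecreasing.
  by exists B => _ [n _ <-].
split=> //; apply: limr_le; first exact/square_summableP.
exact: nearW.
Qed.

Lemma sqnorm_eq0 x : x \in square_summable -> sqnorm x = 0 -> x = 0.
Proof.
move=> sx x0; apply/funext => n; apply/eqP; rewrite -[_ == _]/(x n == 0).
have := le_sqnorm n.+1 sx; rewrite x0 seriesEnat /= big_nat_recr //= => xn.
have : normc (x n) ^+ 2 <= 0.
  by apply: le_trans xn; rewrite lerDr sumr_ge0// => i _; exact: sqr_ge0.
by rewrite exprn_even_le0 //= => /eqP/eq0_normc ->.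
Qed.

Lemma minkowski_sum x y : x \in square_summable -> y \in square_summable ->
  x + y \in square_summable /\
  sqnorm (x + y) <= (Num.sqrt (sqnorm x) + Num.sqrt (sqnorm y)) ^+ 2.
Proof.
move=> sx sy.
set a := Num.sqrt (sqnorm x); set b := Num.sqrt (sqnorm y).
have [a0|a0] := eqVneq a 0.
  have /(sqnorm_eq0 sx) -> : sqnorm x = 0.
    by apply/eqP; rewrite eq_le sqnorm_ge0 // andbT -sqrtr_eq0 -/a a0.
  by rewrite add0r a0 add0r sqr_sqrtr // sqnorm_ge0.
have [b0|b0] := eqVneq b 0.
  have /(sqnorm_eq0 sy) -> : sqnorm y = 0.
    by apply/eqP; rewrite eq_le sqnorm_ge0 // andbT -sqrtr_eq0 -/b b0.
  by rewrite addr0 b0 addr0 sqr_sqrtr // sqnorm_ge0.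
have {}a0 : 0 < a by rewrite lt_def a0 sqrtr_ge0.
have {}b0 : 0 < b by rewrite lt_def b0 sqrtr_ge0.
have a2 : a ^+ 2 = sqnorm x by rewrite sqr_sqrtr // sqnorm_ge0.
have b2 : b ^+ 2 = sqnorm y by rewrite sqr_sqrtr // sqnorm_ge0.
apply: sqnorm_le => n; rewrite seriesEnat /=.
apply: (@le_trans _ _ ((a + b) *
   (a^-1 * \sum_(0 <= k < n) normc (x k) ^+ 2 +
    b^-1 * \sum_(0 <= k < n) normc (y k) ^+ 2))).
  rewrite !mulr_sumr -big_split /= mulr_sumr; apply: ler_sum => k _.
  have /= h : normc (x k + y k) <= normc (x k) + normc (y k) := le_normcD _ _.
  have p0 : 0 <= normc (x k + y k) by case: (x k + y k) => c d; exact: sqrtr_ge0.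
  apply: (@le_trans _ _ ((normc (x k) + normc (y k)) ^+ 2)).
    by rewrite ler_sqr ?nnegrE // (le_trans p0).
  set s := normc (x k); set t := normc (y k).
  rewrite -subr_ge0.
  have -> : (a + b) * (a^-1 * s ^+ 2 + b^-1 * t ^+ 2) - (s + t) ^+ 2 =
     (b * s - a * t) ^+ 2 / (a * b) by field; rewrite !gt_eqF.
  by rewrite divr_ge0 ?sqr_ge0 // mulr_ge0 // ltW.
apply: (@le_trans _ _ ((a + b) * (a^-1 * a ^+ 2 + b^-1 * b ^+ 2))).
  have := le_sqnorm n sx; have := le_sqnorm n sy; rewrite a2 b2 seriesEnat /=.
  move=> hy hx; rewrite ler_pM2l ?addr_gt0 //.
  by apply: lerD; rewrite ler_pM2l // invr_gt0.
have -> // : (a + b) * (a^-1 * a ^+ 2 + b^-1 * b ^+ 2) = (a + b) ^+ 2.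
by field; rewrite !gt_eqF.
Qed.

Lemma scale_sqnorm (a : R[i]) x : x \in square_summable ->
  a *: x \in square_summable /\ sqnorm (a *: x) = normc a ^+ 2 * sqnorm x.
Proof.
move=> /square_summableP cx.
have E : series (fun n => normc ((a *: x) n) ^+ 2) =
  (normc a ^+ 2) *: series (fun n => normc (x n) ^+ 2).
  apply/funext => n; rewrite /series /= -[RHS]/(normc a ^+ 2 * _) mulr_sumr.
  by apply: eq_bigr => k _; rewrite normcM exprMn.
split; first by apply/square_summableP; rewrite E; exact: is_cvgZr.
by rewrite /sqnorm E limZr.
Qed.

Lemma square_summable0 : (0 : nat -> complex1 R) \in square_summable.
Proof.
case: (@sqnorm_le 0 0) => // n; rewrite /series /= big1 // => i _.
by rewrite -[X in X ^+ _]/(@normc R 0) normc0 expr0n.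
Qed.

Lemma square_summable_submod_closed : submod_closed square_summable.
Proof.
split; first exact: square_summable0.
by move=> a x y sx sy; case: (minkowski_sum (scale_sqnorm a sx).1 sy).
Qed.

HB.instance Definition _ :=
  GRing.isSubmodClosed.Build R[i] (nat -> complex1 R) square_summable
    square_summable_submod_closed.

End SquareSummable.

Record ell2 (R : realType) := Ell2 {
  ell2_seq :> nat -> complex1 R ;
  ell2_seqP : ell2_seq \in @square_summable R
}.

Section Ell2.
Variable R : realType.

HB.instance Definition _ := [isSub for @ell2_seq R].
HB.instance Definition _ := [Choice of ell2 R by <:].
HB.instance Definition _ := [SubChoice_isSubLmodule of ell2 R by <:].

Definition ell2_norm (x : ell2 R) : R[i] := (Num.sqrt (sqnorm x))%:C.

Lemma ell2_normD x y : ell2_norm (x + y) <= ell2_norm x + ell2_norm y.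
Proof.
rewrite /ell2_norm -rmorphD /= lecR.
rewrite -(ler_sqr (x := Num.sqrt (sqnorm (x + y)))) ?nnegrE ?addr_ge0 ?sqrtr_ge0 //.
rewrite sqr_sqrtr ?sqnorm_ge0 ?ell2_seqP //.
by case: (minkowski_sum (ell2_seqP x) (ell2_seqP y)).
Qed.

Lemma ell2_normZ (a : R[i]) x : ell2_norm (a *: x) = `|a| * ell2_norm x.
Proof.
have [_ e] := scale_sqnorm a (ell2_seqP x).
have a0 : 0 <= normc a by case: (a) => c d; exact: sqrtr_ge0.
rewrite /ell2_norm /= e sqrtrM ?sqr_ge0 // sqrtr_sqr ger0_norm //.
exact: (rmorphM (real_complex R)).
Qed.

Lemma ell2_norm_eq0 x : ell2_norm x = 0 -> x = 0.
Proof.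
case=> /eqP; rewrite sqrtr_eq0 => x0; apply: val_inj => /=.
by apply: (sqnorm_eq0 (ell2_seqP x)); apply/eqP;
  rewrite eq_le x0 sqnorm_ge0 // ell2_seqP.
Qed.

HB.instance Definition _ :=
  Lmodule_isNormed.Build R[i] (ell2 R) ell2_normD ell2_normZ ell2_norm_eq0.

End Ell2.

(* Curves are parametrised by the real line, whereas W is a complex normed
   space: the difference quotient is scaled through R -> R[i]. *)
Section Velocity.
Variables (R : realType) (W : normedModType R[i]).

Definition difference_quotient (c : R -> W) (t h : R) : W :=
  (h%:C)^-1 *: (c (t + h) - c t).

Definition has_velocity (c : R -> W) (t : R) (v : W) : Prop :=
  difference_quotient c t h @[h --> 0^'] --> v.

Definition velocity (c : R -> W) (t : R) : W :=
  lim (difference_quotient c t h @[h --> 0^']).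

End Velocity.

(* Differential forms on a complex vector space V, viewed as a manifold: the
   tangent space at each point is V, with complex structure v |-> 'i *: v. *)
Section Forms.
Variables (R : realType) (V : lmodType R[i]).
Implicit Types (f : V -> complex1 R) (p u v : V).

Definition two_form := V -> V -> V -> R[i].

Definition rderive f p u : R[i] :=
  velocity (fun t : R => f (p + t%:C *: u)) 0.

Definition del f p u : R[i] :=
  2^-1 * (rderive f p u - 'i * rderive f p ('i *: u)).

Definition delbar f p u : R[i] :=
  2^-1 * (rderive f p u + 'i * rderive f p ('i *: u)).

(* In coordinates this is
   \sum_(j, k) (d^2 f / dz_j dzbar_k) (u_j * conj v_k - v_j * conj u_k),
   i.e. dz_j /\ dzbar_k is normalised without a factor 1/2. *)
Definition del_delbar f : two_form := fun p u v =>
  del (fun q => delbar f q v) p u - del (fun q => delbar f q u) p v.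

Definition form_of_potential f : two_form := fun p u v =>
  'i / 2 * del_delbar f p u v.

End Forms.

Definition flat_form (R : realType) : two_form (ell2 R) :=
  form_of_potential (fun z : ell2 R => `|z| ^+ 2).

(* Differentiability over the scalar field R[i] is complex differentiability. *)
Definition holomorphic (R : realType) (V W : normedModType R[i]) (F : V -> W) :=
  forall p, differentiable F p.

Definition pullback (R : realType) (V W : normedModType R[i]) (F : V -> W)
    (omega : two_form W) : two_form V :=
  fun p u v => omega (F p) ('d F p u) ('d F p v).

Definition kahler_immersion (R : realType) (V : normedModType R[i])
    (omega : two_form V) (F : V -> ell2 R) : Prop :=
  holomorphic F /\ pullback F (@flat_form R) = omega.

Section Submanifolds.
Variable R : realType.
Implicit Types (M E : set (ell2 R)) (p v : ell2 R).

Definition linear_subspace E : Prop :=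
  E 0 /\ forall (a : R[i]) x y, E x -> E y -> E (a *: x + y).

(* phi : U -> U' is biholomorphic with inverse psi and straightens M to the
   closed subspace E; in a Hilbert space E is automatically complemented. *)
Definition complex_submanifold M : Prop :=
  forall p, M p -> exists (E U U' : set (ell2 R)) (phi psi : ell2 R -> ell2 R),
    [/\ linear_subspace E /\ closed E,
        open U /\ open U',
        U p,
        (forall x, U x ->
           [/\ differentiable phi x, U' (phi x), psi (phi x) = x
             & M x <-> E (phi x)])
      & forall y, U' y ->
           [/\ differentiable psi y, U (psi y) & phi (psi y) = y] ].

Definition tangent M p v : Prop :=
  exists c : R -> ell2 R,
    [/\ c 0 = p, \forall t \near (0 : R), M (c t) & has_velocity c 0 v].

(* The Levi-Civita connection of the flat metric is the ordinary derivative,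
   so the geodesic equation is c'' = 0. *)
Definition geodesic (c c' : R -> ell2 R) : Prop :=
  forall t, has_velocity c t (c' t) /\ has_velocity c' t 0.

(* Helgason's definition (Differential Geometry, Lie Groups, and Symmetric
   Spaces, I.14): every ambient geodesic tangent to M at one of its points is a
   curve in M.  Geodesics being defined on the whole real line, this excludes
   proper open subsets of affine subspaces, in particular the complement of a
   point in ell2, so that "proper" can mean M <> setT. *)
Definition totally_geodesic M : Prop :=
  forall c c' : R -> ell2 R, geodesic c c' ->
    M (c 0) -> tangent M (c 0) (c' 0) -> forall t, M (c t).

Definition full (T : Type) (F : T -> ell2 R) : Prop :=
  forall M, complex_submanifold M -> totally_geodesic M -> M <> setT ->
    ~ (range F `<=` M).

End Submanifolds.

Definition cexp (R : realType) (z : R[i]) : R[i] :=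
  (expR (complex.Re z))%:C * (cos (complex.Im z) +i* sin (complex.Im z)).

Definition Phi (R : realType) (p : complex2 R) : complex1 R :=
  cexp (4^-1 * `|p.1| ^+ 2 - 'i / 4 * (p.2 - p.2^*)).

(* Main.v *)
(* The immersion is F(z, w) = e^(-iw/4) (z^k / (2^k sqrt (k!)))_k, for which
   |F|^2 = Phi.  For any holomorphic F into ell2, del delbar of |F|^2 only sees
   the first derivative of F, so it is the pullback of the flat form.

   For fullness, let M be a totally geodesic submanifold containing the image.
   Its tangent spaces are closed complex subspaces, and x + T_x M is contained in
   M for every x in M.  If f is a curve in M, this lets one show by induction on
   k, with no appeal to the inverse function theorem, that every derivative of f
   is tangent to M at f.  Applied at F(0, 0) along both axes this produces the
   whole Hilbert basis, so that M is everything. *)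

Require Import Defs.
From HB Require Import structures.
From mathcomp Require Import all_boot all_order all_algebra.
From mathcomp Require Import all_classical all_reals all_analysis.
From mathcomp Require Import complex ring lra.

Set Implicit Arguments.
Unset Strict Implicit.
Unset Printing Implicit Defensive.

Import Order.TTheory GRing.Theory Num.Theory numFieldNormedType.Exports.
Import ComplexField.Normc.

Local Open Scope classical_set_scope.
Local Open Scope ring_scope.
Local Open Scope complex_scope.

(** [del] and [delbar] are built from real directional derivatives, while F is differentiable over
    [R[i]]. The bridge is a calculus of velocities of real curves in complex normed spaces, with a
    chain rule and a product rule for real-bilinear maps. The obstacle to fullness is that tangency
    of f' to M along f does not by itself pass to f'', since the tangent space moves with the point.
    Instead of differentiating tangent spaces, one shows that the whole complex line through f in
    the direction of the next derivative lies in M; that derivative is then a velocity in M. Both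
    axes are needed: at the origin the z-derivative of order m is a nonzero multiple of the basis
    vector e_m, but order 0 is the point F(0, 0) itself, not a tangent vector. The missing e_0 comes
    from the w-axis, where the derivative is -(i/4) F. On the analytic side one majorant serves
    throughout: coordinates bounded by C r^k / sqrt(k!) have squares summing to at most C^2
    exp(r^2). *)

Section RealNorm.
Variables (R : realType) (W : normedModType R[i]).
Implicit Types x y : W.

(** Norms here take values in [R[i]], which is only partially ordered; [rnorm] moves the estimates
    to the totally ordered field [R]. *)
Definition rnorm x : R := complex.Re `|x|.

Lemma rnormE x : `|x| = (rnorm x)%:C.
Proof.
have := normr_ge0 x; rewrite /rnorm; case: `|x| => a b /=.
by rewrite lecE /= => /andP[/eqP -> _].
Qed.

Lemma rnorm_ge0 x : 0 <= rnorm x.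
Proof. by have := normr_ge0 x; rewrite rnormE lecR. Qed.

Lemma rnormD x y : rnorm (x + y) <= rnorm x + rnorm y.
Proof. by have := ler_normD x y; rewrite !rnormE -rmorphD lecR. Qed.

Lemma rnormN x : rnorm (- x) = rnorm x.
Proof. by rewrite /rnorm normrN. Qed.

Lemma rnorm0 : rnorm 0 = 0.
Proof. by rewrite /rnorm normr0. Qed.

Lemma rnormZ a x : rnorm (a *: x) = normc a * rnorm x.
Proof. by rewrite /rnorm normrZ [`|x|]rnormE normc_def; case: a => a b /=; ring. Qed.

Lemma rnorm_eq0 x : rnorm x = 0 -> x = 0.
Proof. by move=> x0; apply/eqP; rewrite -normr_eq0 rnormE x0. Qed.

Lemma rnormZr (h : R) x : rnorm (h%:C *: x) = `|h| * rnorm x.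
Proof. by rewrite rnormZ /= expr0n addr0 sqrtr_sqr. Qed.

Lemma nbhs_rnormP x (P : set W) :
  (\forall y \near x, P y) <-> exists2 d : R, 0 < d & forall y, rnorm (y - x) < d -> P y.
Proof.
split.
  move=> /nbhs_normP[[d d'] /= d0 xP].
  have [dr d'0] : 0 < d /\ d' = 0 by move: d0; rewrite ltcE /= => /andP[/eqP].
  exists d => // y yd; apply: xP => /=.
  by rewrite -/(ball_ _ _ _) /ball_ /= distrC rnormE d'0 ltcR.
move=> [d d0 H]; apply/nbhs_normP; exists d%:C; first by rewrite /= ltcR.
by move=> y /=; rewrite /ball_ /= distrC rnormE ltcR => /H.
Qed.

End RealNorm.

Lemma rnorm_complex (R : realType) (x : complex1 R) : rnorm x = normc x.
Proof. by rewrite /rnorm normc_def; case: x. Qed.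

(** * Velocities of real curves in complex normed spaces *)

Section Velocity.
Variables (R : realType) (W : normedModType R[i]).
Implicit Types (c d : R -> W) (v w : W) (t : R).

(** Multiplying the difference quotient out by h gives a condition that is also true at h = 0, so
    later estimates need no case distinction. *)
Lemma has_velocityP c t v : has_velocity c t v <->
  forall e : R, 0 < e -> exists2 d : R, 0 < d &
    forall h, `|h| < d -> rnorm (c (t + h) - c t - h%:C *: v) <= e * `|h|.
Proof.
have E h : h != 0 -> rnorm (v - difference_quotient c t h) =
    `|h|^-1 * rnorm (c (t + h) - c t - h%:C *: v).
  move=> h0; rewrite -normfV -rnormZr -rnormN; congr rnorm.
  rewrite opprB scalerBr scalerA -rmorphM mulVf // rmorph1 scale1r.
  by rewrite /difference_quotient fmorphV.
rewrite /has_velocity; split.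
  move=> /cvgrPdist_le H e e0.
  have /H : 0 < e%:C :> R[i] by rewrite ltcR.
  move=> /nbhs_normP[d /= d0 {}H]; exists d => // h hd.
  have [->|h0] := eqVneq h 0.
    by rewrite addr0 subrr scale0r subr0 rnorm0 normr0 mulr0.
  have hb : ball_ Num.norm 0 d h by rewrite /ball_ /= sub0r normrN.
  have := H h hb h0; rewrite rnormE lecR E // => H'.
  by rewrite mulrC -ler_pdivrMl ?normr_gt0.
move=> H; apply/cvgrPdist_le => -[e e'] e0.
have [er ->] : 0 < e /\ e' = 0 by move: e0; rewrite ltcE /= => /andP[/eqP].
have [d d0 {}H] := H _ er; apply/nbhs_normP; exists d => //= h.
rewrite /ball_ /= sub0r normrN => hd h0.
by rewrite rnormE lecR E // ler_pdivrMl ?normr_gt0 // mulrC; exact: H.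
Qed.

Lemma has_velocity_unique c t v w :
  has_velocity c t v -> has_velocity c t w -> v = w.
Proof. exact: cvg_unique. Qed.

Lemma velocityE c t v : has_velocity c t v -> velocity c t = v.
Proof. exact: cvg_lim. Qed.

Lemma has_velocity_near c d t v : (\forall s \near t, c s = d s) ->
  has_velocity c t v -> has_velocity d t v.
Proof.
move=> /nbhs_normP[r /= r0 H] /has_velocityP cv; apply/has_velocityP => e /cv[s s0 {}cv].
exists (Num.min r s); first by rewrite lt_min r0.
move=> h; rewrite lt_min => /andP[hr hs]; rewrite -H; last by rewrite /= opprD addNKr normrN.
by rewrite -H ?cv //= subrr normr0.
Qed.

Lemma has_velocityD c d t v w : has_velocity c t v -> has_velocity d t w ->
  has_velocity (fun s => c s + d s) t (v + w).
Proof.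
move=> cv dw; rewrite /has_velocity.
rewrite (_ : difference_quotient _ _ =
  fun h => difference_quotient c t h + difference_quotient d t h); first exact: cvgD.
by apply/funext => h; rewrite /difference_quotient -scalerDr opprD addrACA.
Qed.

Lemma has_velocityZ (a : R[i]) c t v : has_velocity c t v ->
  has_velocity (fun s => a *: c s) t (a *: v).
Proof.
move=> cv; rewrite /has_velocity.
rewrite (_ : difference_quotient _ _ =
  fun h => a *: difference_quotient c t h); first exact: cvgZr.
by apply/funext => h; rewrite /difference_quotient -scalerBr scalerA mulrC -scalerA.
Qed.

Lemma has_velocity_shift c s v :
  has_velocity c s v -> has_velocity (fun u => c (s + u)) 0 v.
Proof.
move=> /has_velocityP H; apply/has_velocityP => e /H[d d0 Hd].
by exists d => // h /Hd; rewrite addr0 add0r.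
Qed.

Lemma has_velocity_cst v t : has_velocity (fun=> v) t 0.
Proof.
apply/has_velocityP => e e0; exists 1 => // h _.
by rewrite subrr scaler0 subr0 rnorm0 mulr_ge0 // ltW.
Qed.

Lemma has_velocity_sum n (c : nat -> R -> W) t (v : nat -> W) :
  (forall i, has_velocity (c i) t (v i)) ->
  has_velocity (fun s => \sum_(i < n) c i s) t (\sum_(i < n) v i).
Proof.
move=> cv; elim: n => [|n ih].
  by rewrite big_ord0; under [fun s => _]eq_fun do rewrite big_ord0;
     exact: has_velocity_cst.
rewrite big_ord_recr /=; under [fun s => _]eq_fun do rewrite big_ord_recr /=.
exact: has_velocityD.
Qed.

Lemma has_velocity_line (p v : W) (t : R) : has_velocity (fun s => p + s%:C *: v) t v.
Proof.
apply/has_velocityP => e e0; exists 1 => // h _.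
suff -> : p + (t + h)%:C *: v - (p + t%:C *: v) - h%:C *: v = 0.
  by rewrite rnorm0 mulr_ge0 // ltW.
by rewrite rmorphD /= scalerDl [p + (_ + _)]addrA [p + _ + _]addrC addrK subrr.
Qed.

Lemma has_velocity_bounded c t v : has_velocity c t v ->
  exists d C : R, [/\ 0 < d, 0 < C &
    forall h, `|h| < d -> rnorm (c (t + h) - c t) <= C * `|h|].
Proof.
move=> /has_velocityP /(_ 1 ltr01)[d d0 H]; exists d, (1 + rnorm v); split=> //.
  by rewrite ltr_wpDr // rnorm_ge0.
move=> h /H; rewrite mul1r => H'; rewrite -[X in rnorm X](subrK (h%:C *: v)).
by apply: le_trans (rnormD _ _) _; rewrite rnormZr mulrDl mul1r lerD // mulrC.
Qed.

End Velocity.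

Arguments has_velocity_line {R W}.

(** * Complex differentials applied to real curves *)

Section Differential.
Variables (R : realType) (V W : normedModType R[i]).

(** Continuity at 0 gives a radius d on which L has norm below 1; rescaling x to norm d / 2 yields
    the constant 2 / d. *)
Lemma linear_rnorm_bounded (L : {linear V -> W}) : continuous L ->
  exists2 C : R, 0 < C & forall x, rnorm (L x) <= C * rnorm x.
Proof.
move=> Lc; have /nbhs_rnormP[d d0 H] : \forall y \near (0 : V), rnorm (L y) < 1.
  have : \forall y \near (L 0), rnorm y < 1.
    by apply/nbhs_rnormP; exists 1 => // y; rewrite linear0 subr0.
  by move=> /(Lc 0).
exists (2 / d); first by rewrite divr_gt0.
move=> x; have [x0|x0] := eqVneq (rnorm x) 0.
  by rewrite (rnorm_eq0 x0) linear0 !rnorm0 mulr0.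
have {}x0 : 0 < rnorm x by rewrite lt_def x0 rnorm_ge0.
set a := d / 2 / rnorm x; have a0 : 0 < a by rewrite !divr_gt0.
have ax : a * rnorm x < d.
  by rewrite /a divfK ?gt_eqF // ltr_pdivrMr // ltr_pMr // ltr1n.
have := H (a%:C *: x); rewrite linearZ /= subr0 !rnormZr gtr0_norm //.
move=> /(_ ax)/ltW H'.
have -> : rnorm (L x) = (2 / d * rnorm x) * (a * rnorm (L x)).
  by rewrite /a; field; rewrite !gt_eqF.
by rewrite ler_piMr // mulr_ge0 ?divr_ge0 // ltW.
Qed.

Lemma differentiable_rnorm (f : V -> W) x : differentiable f x ->
  forall e : R, 0 < e -> exists2 d : R, 0 < d & forall k, rnorm k < d ->
    rnorm (f (x + k) - f x - 'd f x k) <= e * rnorm k.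
Proof.
move=> /diff_locally /eqaddoP H e e0.
have /H : 0 < e%:C :> R[i] by rewrite ltcR.
move=> /nbhs_rnormP[d d0 {}H]; exists d => // k kd.
have := H k; rewrite subr0 => /(_ kd) /=.
rewrite !rnormE -rmorphM lecR.
suff -> : f (x + k) - f x - 'd f x k = f (k + x) - (f x + 'd f x k) by [].
by rewrite opprD addrA [k + x]addrC.
Qed.

(** The chain rule mixes two scalar fields. Half of e pays for the remainder of f at an increment of
    size at most C |h|, the other half for the remainder of c sent through the bounded map
    ['d f (c t)]. *)
Lemma has_velocity_comp (f : V -> W) (c : R -> V) t v :
  differentiable f (c t) -> has_velocity c t v ->
  has_velocity (fun s => f (c s)) t ('d f (c t) v).
Proof.
move=> df cv; apply/has_velocityP => e e0.
have [K K0 HK] := linear_rnorm_bounded (diff_continuous df).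
have [d1 [C [d10 C0 HC]]] := has_velocity_bounded cv.
have [|d2 d20 H2] := differentiable_rnorm df (e := e / 2 / C).
  by rewrite !divr_gt0.
move/has_velocityP: cv => /(_ (e / 2 / K))[|d3 d30 H3]; first by rewrite !divr_gt0.
exists (Num.min (Num.min d1 d3) (d2 / C)).
  by rewrite !lt_min d10 d30 divr_gt0.
move=> h; rewrite !lt_min => /andP[/andP[h1 h3] h2].
set k := c (t + h) - c t.
have kC : rnorm k <= C * `|h| := HC _ h1.
have kd : rnorm k < d2 by apply: le_lt_trans kC _; rewrite mulrC -ltr_pdivlMr.
have ck : c t + k = c (t + h) by rewrite /k addrC subrK.
have := H2 _ kd; rewrite ck => H2'.
have -> : f (c (t + h)) - f (c t) - h%:C *: 'd f (c t) v =
   (f (c (t + h)) - f (c t) - 'd f (c t) k) + 'd f (c t) (k - h%:C *: v).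
  by rewrite (linearB _ k) addrA subrK [in RHS]linearZ.
apply: le_trans (rnormD _ _) _.
rewrite [e]splitr mulrDl lerD //.
  apply: le_trans H2' _; rewrite -mulrA -ler_pdivlMl ?divr_gt0 //.
  by rewrite mulKf ?gt_eqF ?divr_gt0 // ler_pdivrMl.
apply: le_trans (HK _) _; rewrite -ler_pdivlMl // mulrA [K^-1 * _]mulrC; exact: H3.
Qed.

End Differential.

Lemma closed_rnorm (R : realType) (W : normedModType R[i]) (E : set W) x :
  closed E -> (forall e : R, 0 < e -> exists2 y, E y & rnorm (y - x) < e) -> E x.
Proof.
move=> Ec H; apply: Ec => B /nbhs_rnormP[d d0 dB].
by have [y Ey yx] := H _ d0; exists y; split=> //; exact: dB.
Qed.

(** * Tangent spaces of a totally geodesic submanifold *)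

Section TotallyGeodesic.
Variables (R : realType) (M : set (ell2 R)).
Implicit Types (p v : ell2 R).

Hypothesis subM : complex_submanifold M.

(** A chart turns tangency into membership in E, with L = ['d phi p]. Difference quotients of phi
    along a curve in M lie in E, hence so does their limit, as E is closed; conversely a line in E
    through phi(p) is carried into M by psi. Linearity and closedness of the tangent space follow
    from this. *)
Lemma tangentP p : M p -> exists (E : set (ell2 R)) (L : {linear ell2 R -> ell2 R}),
  [/\ linear_subspace E, closed E, continuous L & forall v, tangent M p v <-> E (L v)].
Proof.
move=> /[dup] Mp /subM[E [U [U' [phi [psi [[Elin Ecl] [Uo U'o] Up phiP psiP]]]]]].
have [dphi U'p psip MEp] := phiP _ Up; have Ep := MEp.1 Mp.
have [dpsi _ _] := psiP _ U'p.
have openU q : U q -> \forall y \near q, U y by move=> Uq; exact: open_nbhs_nbhs.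
have openU' q : U' q -> \forall y \near q, U' y by move=> Uq; exact: open_nbhs_nbhs.
(* A curve with a velocity at 0 is continuous there, so it stays in any given neighbourhood of [c 0]
   for small times. *)
have small (c : R -> ell2 R) v (B : set (ell2 R)) :
    has_velocity c 0 v -> (\forall y \near c 0, B y) -> \forall s \near 0, B (c s).
  move=> /has_velocity_bounded[d [C [d0 C0 Hd]]] /nbhs_rnormP[r r0 Hr].
  apply/nbhs_normP; exists (Num.min d (r / C)) => /=.
    by rewrite lt_min d0 divr_gt0.
  move=> s /=; rewrite sub0r normrN lt_min => /andP[sd sr]; apply: Hr.
  have := Hd s sd; rewrite add0r => /le_lt_trans; apply.
  by rewrite mulrC -ltr_pdivlMr.
exists E, 'd phi p; split=> //; first exact: diff_continuous.
move=> v; split.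
  move=> [c [c0 cM cv]].
  have /has_velocityP H : has_velocity (fun s => phi (c s)) 0 ('d phi p v).
    by rewrite -c0; apply: has_velocity_comp => //; rewrite c0.
  apply: closed_rnorm => // e e0.
  have [d d0 {}H] := H _ (divr_gt0 e0 (ltr0n R 2)).
  have Uc : \forall s \near 0, U (c s) by apply: small cv _; rewrite c0; exact: openU.
  have /nbhs_normP[r /= r0 Hr] : \forall s \near 0, U (c s) /\ M (c s).
    by near=> s; split; near: s.
  pose h := Num.min d r / 2.
  have m0 : 0 < Num.min d r by rewrite lt_min d0.
  have h0 : 0 < h by rewrite divr_gt0.
  have hm : h < Num.min d r by rewrite ltr_pdivrMr // ltr_pMr // ltr1n.
  have /andP[hd hr] : (h < d) && (h < r) by rewrite -lt_min.
  exists ((h%:C)^-1 *: (phi (c h) - phi (c 0))).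
    have [Uh Mh] : U (c h) /\ M (c h).
      by apply: Hr; rewrite /= sub0r normrN gtr0_norm.
    have [_ _ _ /iffLR/(_ Mh) Eh] := phiP _ Uh.
    rewrite c0 -[_ *: _]addr0; apply: Elin.2 Elin.1.
    by rewrite addrC -scaleN1r; apply: Elin.2.
  have := H h; rewrite add0r gtr0_norm // => /(_ hd) H'.
  have -> : (h%:C)^-1 *: (phi (c h) - phi (c 0)) - 'd phi p v =
     (h^-1)%:C *: (phi (c h) - phi (c 0) - h%:C *: 'd phi p v).
    rewrite [RHS]scalerBr scalerA -rmorphM mulVf ?gt_eqF // rmorph1 scale1r.
    by rewrite fmorphV.
  rewrite rnormZr gtr0_norm ?invr_gt0 // mulrC ltr_pdivrMr //.
  by apply: le_lt_trans H' _; rewrite ltr_pM2r // ltr_pdivrMr // ltr_pMr // ltr1n.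
move=> Ev; exists (fun t => psi (phi p + t%:C *: 'd phi p v)); split.
- by rewrite scale0r addr0.
- have : \forall s \near (0 : R), U' (phi p + s%:C *: 'd phi p v).
    have := small _ _ U' (has_velocity_line (phi p) ('d phi p v) 0).
    by rewrite scale0r addr0; apply; exact: openU'.
  apply: filterS => s /psiP[_ Us phis].
  have [_ _ _ [_]] := phiP _ Us; apply; rewrite phis addrC.
  exact: Elin.2.
(* Near 0 the curve psi(phi(p + s v)) is the line p + s v; uniqueness of velocities gives the
   identity. *)
- have dp : 'd psi (phi p) ('d phi p v) = v.
    have line := has_velocity_line p v 0.
    have p0 : p + 0%:C *: v = p by rewrite scale0r addr0.
    have v1 : has_velocity (fun s : R => phi (p + s%:C *: v)) 0 ('d phi p v).
      by rewrite -[X in 'd phi X]p0; apply: has_velocity_comp line; rewrite p0.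
    have v2 : has_velocity (fun s : R => psi (phi (p + s%:C *: v))) 0
        ('d psi (phi p) ('d phi p v)).
      by rewrite -[X in phi X]p0; apply: has_velocity_comp v1; rewrite p0.
    apply: (has_velocity_unique _ line); apply: has_velocity_near v2.
    have : \forall s \near (0 : R), U (p + s%:C *: v).
      by apply: (small _ _ U line); rewrite p0; exact: openU.
    by apply: filterS => s /phiP[].
  rewrite -[X in has_velocity _ _ X]dp.
  have p0 : phi p + 0%:C *: 'd phi p v = phi p by rewrite scale0r addr0.
  rewrite -[X in 'd psi X]p0.
  by apply: has_velocity_comp; [rewrite p0|exact: has_velocity_line].
Unshelve. all: by end_near. Qed.

Lemma tangent_linear p : M p -> linear_subspace (tangent M p).
Proof.
move=> /tangentP[E [L [[E0 Elin] _ _ TE]]]; split; first by apply/TE; rewrite linear0.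
by move=> a x y /TE Ex /TE Ey; apply/TE; rewrite linearP; exact: Elin.
Qed.

Lemma tangent_closed p v : M p ->
  (forall e : R, 0 < e -> exists2 w, tangent M p w & rnorm (w - v) < e) ->
  tangent M p v.
Proof.
move=> /tangentP[E [L [_ Ecl Lc TE]]] H; apply/TE; apply: closed_rnorm => // e e0.
have [C C0 HC] := linear_rnorm_bounded Lc.
have [w /TE Ew wv] := H _ (divr_gt0 e0 C0).
exists (L w) => //; rewrite -linearB (le_lt_trans (HC _)) //.
by rewrite mulrC -ltr_pdivlMr.
Qed.

Hypothesis geoM : totally_geodesic M.

(** The line t |-> p + t v is a geodesic of the flat metric; it is read off at t = 1. *)
Lemma tangent_sub p v : M p -> tangent M p v -> M (p + v).
Proof.
move=> Mp Tv; have p0 : p + 0%:C *: v = p by rewrite scale0r addr0.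
have := geoM (c := fun t : R => p + t%:C *: v) (c' := fun=> v).
rewrite p0 => /(_ _ Mp Tv 1); rewrite scale1r; apply => t.
by split; [exact: has_velocity_line|exact: has_velocity_cst].
Qed.

Lemma tangentZ p v (a : R[i]) : M p -> tangent M p v -> tangent M p (a *: v).
Proof.
by move=> /tangent_linear[T0 Tlin] Tv; rewrite -[_ *: _]addr0; exact: Tlin.
Qed.

Lemma tangent_sum p n (v : 'I_n -> ell2 R) : M p ->
  (forall i, tangent M p (v i)) -> tangent M p (\sum_i v i).
Proof.
move=> /tangent_linear[T0 Tlin] Tv; apply: (big_ind (tangent M p)) => // x y Tx Ty.
by rewrite -[x]scale1r; exact: Tlin.
Qed.

(* Once f_1, ..., f_k are known to be tangent, x = sum_(i <= k) r^i f_i is a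
   curve in M, and x - r x' telescopes to f_0 - r^(k+1) f_(k+1). *)
Lemma tangent_derivatives (f : nat -> R -> ell2 R) :
  (forall k t, has_velocity (f k) t (f k.+1 t)) ->
  (forall t, M (f 0 t)) ->
  forall k t, tangent M (f 0 t) (f k.+1 t).
Proof.
move=> fv Mf k; elim/ltn_ind: k => k ih t.
have Mz (z : R[i]) s : M (f 0 s + z *: f k.+1 s).
  (* With this root the leftover term -r^(k+1) f_(k+1) becomes z f_(k+1). A complex root is
     essential: even for real z there may be no real one. *)
  have [r rk] : exists r : R[i], r ^+ k.+1 = - z.
    by exists (k.+1.-root (- z)); rewrite rootCK.
  pose x u := \sum_(i < k.+1) r ^+ i *: f i u.
  pose x' u := \sum_(i < k.+1) r ^+ i *: f i.+1 u.
  have xv u : has_velocity x u (x' u).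
    apply: (@has_velocity_sum _ _ _ (fun i s => r ^+ i *: f i s) _
      (fun i => r ^+ i *: f i.+1 u)) => i.
    exact: has_velocityZ.
  have Mx u : M (x u).
    rewrite /x big_ord_recl expr0 scale1r; apply: tangent_sub => //.
    by apply: tangent_sum => // i; apply: tangentZ => //; exact: ih.
  have Tx : tangent M (x s) (x' s).
    exists (fun u => x (s + u)); split.
    - by rewrite addr0.
    - by apply/nbhs_normP; exists 1 => //= u _; exact: Mx.
    - exact: has_velocity_shift (xv s).
  suff <- : x s + (- r) *: x' s = f 0 s + z *: f k.+1 s.
    exact: tangent_sub (Mx s) (tangentZ (- r) (Mx s) Tx).
  rewrite /x /x' big_ord_recl big_ord_recr /= expr0 scale1r scaleNr scalerDr scaler_sumr.
  rewrite scalerA -exprS rk scaleNr opprD opprK addrA; congr (_ + _).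
  rewrite -addrA -sumrB big1 ?addr0 // => i _.
  by rewrite scalerA -exprS subrr.
have fk0 : f 0 t + 0%:C *: f k.+1 t = f 0 t by rewrite scale0r addr0.
(* Real values of z already give a line in M whose velocity at 0 is the wanted derivative. *)
exists (fun u : R => f 0 t + u%:C *: f k.+1 t); split=> //.
- by apply/nbhs_normP; exists 1 => //= u _; exact: Mz.
- exact: has_velocity_line.
Qed.

End TotallyGeodesic.

(** * The product rule for bounded real-bilinear maps *)

Section BilinearVelocity.
Variables (R : realType) (U V W : normedModType R[i]) (b : U -> V -> W) (C : R).
Hypothesis C0 : 0 < C.
Hypothesis bDl : forall x y z, b (x + y) z = b x z + b y z.
Hypothesis bDr : forall x y z, b x (y + z) = b x y + b x z.
Hypothesis bZl : forall (r : R) x y, b (r%:C *: x) y = r%:C *: b x y.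
Hypothesis bZr : forall (r : R) x y, b x (r%:C *: y) = r%:C *: b x y.
Hypothesis b_le : forall x y, rnorm (b x y) <= C * (rnorm x * rnorm y).

(** Only real homogeneity is assumed, so that the rule covers both scalar multiplication and the
    hermitian product, which is conjugate-linear in its second variable. The error splits into three
    terms of size at most (e / 3) |h|. *)
Lemma has_velocity_bilinear (c : R -> U) (d : R -> V) t v w :
  has_velocity c t v -> has_velocity d t w ->
  has_velocity (fun s => b (c s) (d s)) t (b v (d t) + b (c t) w).
Proof.
move=> cv dw; apply/has_velocityP => e e0.
have [d1 [K [d10 K0 HK]]] := has_velocity_bounded dw.
set D := rnorm (d t); set N := rnorm (c t); set V0 := rnorm v.
have D0 : 0 <= D := rnorm_ge0 _.
have N0 : 0 <= N := rnorm_ge0 _.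
have V00 : 0 <= V0 := rnorm_ge0 _.
have e3 : 0 < e / 3 / C by rewrite !divr_gt0.
have DK : 0 < D + K by rewrite ltr_wpDl.
have N1 : 0 < N + 1 by rewrite ltr_wpDl.
have VK : 0 < (V0 + 1) * K by rewrite mulr_gt0 // ltr_wpDl.
move/has_velocityP: cv => /(_ _ (divr_gt0 e3 DK))[d2 d20 H2].
move/has_velocityP: dw => /(_ _ (divr_gt0 e3 N1))[d3 d30 H3].
(* The bounds 1 and d1 keep the norm of d(t + h) below D + K; the last bound absorbs the term b(h v,
   d(t + h) - d(t)), quadratic in h. The added 1 in V0 + 1 and N + 1 keeps divisors positive when v
   or c(t) vanishes. *)
exists (Num.min (Num.min 1 d1) (Num.min (Num.min d2 d3) (e / 3 / C / ((V0 + 1) * K)))).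
  by rewrite !lt_min ltr01 d10 d20 d30 divr_gt0.
move=> h; rewrite !lt_min => /andP[/andP[h1 hd1] /andP[/andP[hd2 hd3] hd4]].
have hge := normr_ge0 h.
set c' := c (t + h); set d' := d (t + h).
have bBl x y z : b (x - y) z = b x z - b y z.
  have -> : - y = (-1)%:C *: y by rewrite rmorphN scaleNr scale1r.
  by rewrite bDl bZl rmorphN scaleNr scale1r.
have bBr x y z : b x (y - z) = b x y - b x z.
  have -> : - z = (-1)%:C *: z by rewrite rmorphN scaleNr scale1r.
  by rewrite bDr bZr rmorphN scaleNr scale1r.
have -> : b c' d' - b (c t) (d t) - h%:C *: (b v (d t) + b (c t) w) =
   b (c' - c t - h%:C *: v) d' + b (h%:C *: v) (d' - d t) +
   b (c t) (d' - d t - h%:C *: w).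
  rewrite !bBl !bBr !bZl !bZr scalerDr opprD.
  set X := b c' d'; set Y := b (c t) d'; set Z := h%:C *: b v d'.
  set P := b (c t) (d t); set Q := h%:C *: b v _; set S := h%:C *: b (c t) w.
  rewrite [X - Y - Z + _]addrA subrK [X - Y - Q]addrAC -[Y - P - S]addrA.
  by rewrite [RHS]addrA subrK addrACA.
have d'D : rnorm d' <= D + K.
  rewrite -[d'](subrK (d t)) addrC (le_trans (rnormD _ _)) // lerD2l.
  by rewrite (le_trans (HK _ hd1)) // ler_piMr // ltW.
have E1 : rnorm (b (c' - c t - h%:C *: v) d') <= e / 3 * `|h|.
  rewrite (le_trans (b_le _ _)) // -ler_pdivlMl //.
  have := H2 h hd2; rewrite -/c' => H2'.
  rewrite (le_trans (ler_pM (rnorm_ge0 _) (rnorm_ge0 _) H2' d'D)) //.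
  by rewrite le_eqVlt; apply/orP; left; apply/eqP; field; rewrite !gt_eqF.
have E2 : rnorm (b (h%:C *: v) (d' - d t)) <= e / 3 * `|h|.
  rewrite (le_trans (b_le _ _)) // -ler_pdivlMl // rnormZr -/V0.
  have := HK h hd1; rewrite -/d' => HK'.
  have -> : C^-1 * (e / 3 * `|h|) = `|h| * (e / 3 / C) by ring.
  rewrite -[leLHS]mulrA; apply: ler_wpM2l => //.
  have HK2 : V0 * rnorm (d' - d t) <= (V0 + 1) * (K * `|h|).
    by rewrite ler_pM ?rnorm_ge0 // lerDl.
  by rewrite (le_trans HK2) // mulrA mulrC -ler_pdivlMr // ltW.
have E3 : rnorm (b (c t) (d' - d t - h%:C *: w)) <= e / 3 * `|h|.
  rewrite (le_trans (b_le _ _)) // -ler_pdivlMl //.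
  have := H3 h hd3; rewrite -/d' => H3'.
  have N1' : N <= N + 1 by rewrite lerDl.
  rewrite (le_trans (ler_pM (rnorm_ge0 _) (rnorm_ge0 _) N1' H3')) //.
  by rewrite le_eqVlt; apply/orP; left; apply/eqP; field; rewrite !gt_eqF.
rewrite (le_trans (rnormD _ _)) // (_ : e = e / 3 + e / 3 + e / 3); last by field.
rewrite !mulrDl lerD // (le_trans (rnormD _ _)) // lerD //.
Qed.

End BilinearVelocity.

Lemma has_velocity_scale (R : realType) (W : normedModType R[i])
    (c : R -> complex1 R) (d : R -> W) t v w :
  has_velocity c t v -> has_velocity d t w ->
  has_velocity (fun s => c s *: d s) t (v *: d t + c t *: w).
Proof.
apply: (@has_velocity_bilinear _ _ _ _ (fun (x : complex1 R) y => x *: y) 1) => //.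
- by move=> x y z; rewrite scalerDl.
- by move=> x y z; rewrite scalerDr.
- by move=> r x y; rewrite scalerA.
- by move=> r x y; rewrite !scalerA mulrC.
- by move=> x y; rewrite mul1r rnormZ rnorm_complex.
Qed.

(** * The hermitian product on ell2 and the forms of squared norms *)

Section InnerProduct.
Variable R : realType.
Implicit Types x y z : ell2 R.

Lemma normc_sqr (a : R[i]) : normc a ^+ 2 = complex.Re a ^+ 2 + complex.Im a ^+ 2.
Proof. by case: a => a b /=; rewrite sqr_sqrtr // addr_ge0 ?sqr_ge0. Qed.

Lemma normc_ge0 (a : R[i]) : 0 <= normc a.
Proof. by case: a => a b; exact: sqrtr_ge0. Qed.

Lemma cvg_sqnorm x : series (fun n => normc (x n) ^+ 2) n @[n --> \oo] --> sqnorm x.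
Proof. by have /square_summableP := ell2_seqP x. Qed.

Lemma rnorm_sqr x : rnorm x ^+ 2 = sqnorm x.
Proof. by rewrite /rnorm /= sqr_sqrtr // sqnorm_ge0 // ell2_seqP. Qed.

Definition ipterm x y n : R :=
  complex.Re (x n) * complex.Re (y n) + complex.Im (x n) * complex.Im (y n).

Definition ip x y : R := limn (series (ipterm x y)).

(* Polarisation reduces convergence to that of the squared norms. *)
Lemma cvg_ip x y : series (ipterm x y) n @[n --> \oo] --> ip x y.
Proof.
suff : cvgn (series (ipterm x y)) by [].
pose s : ell2 R := x + y; pose d : ell2 R := x - y.
apply/cvg_ex; exists (4^-1 * (sqnorm s - sqnorm d)).
have -> : series (ipterm x y) = fun n => 4^-1 *
   (series (fun n => normc (s n) ^+ 2) n - series (fun n => normc (d n) ^+ 2) n).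
  apply/funext => n; rewrite /series /= -sumrB mulr_sumr; apply: eq_bigr => k _.
  rewrite !fctE !normc_sqr /ipterm.
  by case: (x k) (y k) => a1 b1 [a2 b2] /=; field.
by apply: cvgMr; apply: cvgB; exact: cvg_sqnorm.
Qed.

Lemma ip_cvgE x y l : series (ipterm x y) n @[n --> \oo] --> l -> ip x y = l.
Proof. exact: cvg_lim. Qed.

Lemma ipxx x : ip x x = rnorm x ^+ 2.
Proof.
rewrite rnorm_sqr; apply: ip_cvgE.
have -> : ipterm x x = fun n => normc (x n) ^+ 2 by apply/funext => n; rewrite normc_sqr.
exact: cvg_sqnorm.
Qed.

Lemma ipC x y : ip x y = ip y x.
Proof.
by congr (limn (series _)); apply/funext => n; rewrite /ipterm mulrC [X in _ + X]mulrC.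
Qed.

Lemma ipDl x y z : ip (x + y) z = ip x z + ip y z.
Proof.
apply: ip_cvgE.
have -> : series (ipterm (x + y) z) =
    fun n => series (ipterm x z) n + series (ipterm y z) n.
  apply/funext => n; rewrite /series /= -big_split; apply: eq_bigr => k _.
  rewrite /ipterm /= !fctE.
  by case: (x k) (y k) => a b [c d] /=; ring.
by apply: cvgD; exact: cvg_ip.
Qed.

Lemma ipZl r x y : ip (r%:C *: x) y = r * ip x y.
Proof.
apply: ip_cvgE.
have -> : series (ipterm (r%:C *: x) y) = fun n => r * series (ipterm x y) n.
  apply/funext => n; rewrite /series /= mulr_sumr; apply: eq_bigr => k _.
  rewrite /ipterm /= !fctE.
  by case: (x k) => a b /=; ring.
by apply: cvgMr; exact: cvg_ip.
Qed.

Lemma ip_i x y : ip ('i *: x) ('i *: y) = ip x y.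
Proof.
congr (limn (series _)); apply/funext => n; rewrite /ipterm.
rewrite -[('i *: x) n]/('i * x n) -[('i *: y) n]/('i * y n) -complexiE.
by case: (x n) (y n) => a b [c d] /=; ring.
Qed.

Lemma ipDr x y z : ip x (y + z) = ip x y + ip x z.
Proof. by rewrite ipC ipDl ipC [ip z x]ipC. Qed.

Lemma ipZr r x y : ip x (r%:C *: y) = r * ip x y.
Proof. by rewrite ipC ipZl ipC. Qed.

Lemma ipNl x y : ip (- x) y = - ip x y.
Proof.
have -> : - x = (-1)%:C *: x by rewrite rmorphN scaleNr scale1r.
by rewrite ipZl mulN1r.
Qed.

Lemma ipNr x y : ip x (- y) = - ip x y.
Proof. by rewrite ipC ipNl ipC. Qed.

Lemma scaleii x : 'i *: ('i *: x) = - x.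
Proof. by rewrite scalerA -expr2 sqrCi scaleN1r. Qed.

Lemma ip_il x y : ip ('i *: x) y = - ip x ('i *: y).
Proof. by rewrite -(ip_i x) scaleii ipNr opprK. Qed.

(** Cauchy-Schwarz: with a = |x| and b = |y|, expanding 0 <= |b x - a y|^2 gives 2ab <x, y> <= 2 a^2
    b^2, and ab is cancelled. *)
Lemma ip_ge x y : ip x y <= rnorm x * rnorm y.
Proof.
have [x0|x0] := eqVneq (rnorm x) 0.
  rewrite (rnorm_eq0 x0) rnorm0 mul0r; have := ipDl 0 0 y; rewrite addr0; lra.
have [y0|y0] := eqVneq (rnorm y) 0.
  rewrite (rnorm_eq0 y0) rnorm0 mulr0; have := ipDr x 0 0; rewrite addr0; lra.
set a := rnorm x; set b := rnorm y.
have ab0 : 0 < a * b by rewrite mulr_gt0 // lt_def rnorm_ge0 andbT.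
have : 0 <= ip (b%:C *: x - a%:C *: y) (b%:C *: x - a%:C *: y).
  by rewrite ipxx sqr_ge0.
rewrite ipDl !ipDr !ipNl !ipNr !ipZl !ipZr !ipxx -/a -/b [ip y x]ipC => H.
rewrite -(ler_pM2l ab0); nra.
Qed.

Lemma norm_ip x y : `|ip x y| <= rnorm x * rnorm y.
Proof.
rewrite ler_norml ip_ge andbT lerNl -ipNl (le_trans (ip_ge _ _)) //.
by rewrite rnormN.
Qed.

(** This is the sum of the x_n conj(y_n), assembled from two real limits: the imaginary part of x_n
    conj(y_n) is the real part of x_n conj(i y_n). *)
Definition hip x y : complex1 R := ip x y +i* ip x ('i *: y).

Lemma hipDl x y z : hip (x + y) z = hip x z + hip y z.
Proof. by rewrite /hip !ipDl. Qed.

Lemma hipDr x y z : hip x (y + z) = hip x y + hip x z.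
Proof. by rewrite /hip scalerDr !ipDr. Qed.

Lemma hipZl (r : R) x y : hip (r%:C *: x) y = r%:C *: hip x y.
Proof. by rewrite /hip !ipZl -[RHS]/(r%:C * _); congr (_ +i* _) => /=; ring. Qed.

Lemma hipZr (r : R) x y : hip x (r%:C *: y) = r%:C *: hip x y.
Proof.
rewrite /hip scalerA mulrC -scalerA !ipZr -[RHS]/(r%:C * _).
by congr (_ +i* _) => /=; ring.
Qed.

Lemma hip_il x y : hip ('i *: x) y = 'i * hip x y.
Proof.
by rewrite /hip ip_i ip_il -complexiE; congr (_ +i* _) => /=; ring.
Qed.

Lemma hip_ir x y : hip x ('i *: y) = - ('i * hip x y).
Proof.
by rewrite /hip scaleii ipNr -complexiE; congr (_ +i* _) => /=; ring.
Qed.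

Lemma hipxx x : hip x x = `|x| ^+ 2.
Proof.
rewrite rnormE -rmorphXn /= -ipxx /hip.
by have := ip_il x x; rewrite ipC => H; congr (_ +i* _); lra.
Qed.

(** Real and imaginary parts are bounded separately; the crude constant 2 suffices for the product
    rule. *)
Lemma hip_le x y : rnorm (hip x y) <= 2 * (rnorm x * rnorm y).
Proof.
rewrite rnorm_complex -(ler_sqr (x := normc _)) ?nnegrE ?normc_ge0 ?mulr_ge0 ?rnorm_ge0 //.
rewrite normc_sqr /hip /=.
have H1 := norm_ip x y; have := norm_ip x ('i *: y).
have -> : rnorm ('i *: y) = rnorm y.
  by rewrite rnormZ -complexiE /= expr0n expr1n add0r sqrtr1 mul1r.
move: H1; set m := rnorm x * rnorm y => H1 H2.
have m0 : 0 <= m by rewrite mulr_ge0 ?rnorm_ge0.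
have S1 : ip x y ^+ 2 <= m ^+ 2 by rewrite -real_normK ?num_real // ler_sqr ?nnegrE.
have S2 : ip x ('i *: y) ^+ 2 <= m ^+ 2 by rewrite -real_normK ?num_real // ler_sqr ?nnegrE.
have -> : (2 * m) ^+ 2 = 4 * m ^+ 2 by ring.
by have := sqr_ge0 m; lra.
Qed.

Lemma has_velocity_hip (c d : R -> ell2 R) t v w :
  has_velocity c t v -> has_velocity d t w ->
  has_velocity (fun s => hip (c s) (d s)) t (hip v (d t) + hip (c t) w).
Proof.
apply: (has_velocity_bilinear (C := 2)) => //.
- exact: hipDl.
- exact: hipDr.
- exact: hipZl.
- exact: hipZr.
- exact: hip_le.
Qed.

End InnerProduct.

(* Complex linearity of G removes the term hip (G q v) (F q) from delbar, and
   that of K removes hip (F p) (K p u v) from del. *)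
Lemma form_of_sqnorm (R : realType) (V : lmodType R[i]) (F : V -> ell2 R)
    (G : V -> V -> ell2 R) (K : V -> V -> V -> ell2 R) :
  (forall q v, has_velocity (fun t : R => F (q + t%:C *: v)) 0 (G q v)) ->
  (forall q u v, has_velocity (fun t : R => G (q + t%:C *: u) v) 0 (K q u v)) ->
  (forall q v, G q ('i *: v) = 'i *: G q v) ->
  (forall q u v, K q ('i *: u) v = 'i *: K q u v) ->
  form_of_potential (fun q => `|F q| ^+ 2) =
  fun p u v => 'i / 2 * (hip (G p u) (G p v) - hip (G p v) (G p u)).
Proof.
move=> FG GK Gi Ki.
have q0 (q v : V) : q + 0%:C *: v = q by rewrite scale0r addr0.
have i2 : 'i * 'i = -1 :> R[i] by rewrite -expr2 sqrCi.
have D1 q v : delbar (fun q => `|F q| ^+ 2) q v = hip (F q) (G q v).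
  have rd w : rderive (fun q => `|F q| ^+ 2 : complex1 R) q w =
      hip (G q w) (F q) + hip (F q) (G q w) :> complex1 R.
    rewrite /rderive; apply: velocityE; have := has_velocity_hip (FG q w) (FG q w); rewrite q0.
    by rewrite (_ : (fun s => hip _ _) = fun s : R => `|F (q + s%:C *: w)| ^+ 2) //;
      apply/funext => s; rewrite hipxx.
  (* The derivative along v is X + Y and the one along i v is i (X - Y), so that [delbar] retains Y
     alone; [del] below retains X by the opposite sign. *)
  rewrite /delbar !rd Gi hip_il hip_ir.
  set X := hip (G q v) (F q); set Y := hip (F q) (G q v).
  transitivity (2^-1 * (X + Y + 'i * 'i * (X - Y))); first by congr (_ * _); ring.
  by rewrite i2; field.
have D2 p u v : del (fun q => delbar (fun q => `|F q| ^+ 2) q v) p u =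
    hip (G p u) (G p v).
  rewrite (_ : (fun q => _) = fun q => hip (F q) (G q v)); last exact/funext.
  have rd w : rderive (fun q => hip (F q) (G q v)) p w =
      hip (G p w) (G p v) + hip (F p) (K p w v) :> complex1 R.
    rewrite /rderive; apply: velocityE.
    by have := has_velocity_hip (FG p w) (GK p w v); rewrite q0.
  rewrite /del !rd Gi Ki hip_il hip_ir.
  set X := hip (G p u) (G p v); set Y := hip (F p) _.
  transitivity (2^-1 * (X + Y - 'i * 'i * (X - Y))); first by congr (_ * _); ring.
  by rewrite i2; field.
apply/funext => p; apply/funext => u; apply/funext => v.
by rewrite /form_of_potential /del_delbar; congr (_ * (_ - _)); exact: D2.
Qed.

(** The flat potential is the squared norm of the identity map, so the general formula applies, with
    zero second derivative; comparing it with the formula for F makes the pullback identity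
    immediate. *)
Lemma flat_formE (R : realType) :
  @flat_form R = fun p u v => 'i / 2 * (hip u v - hip v u).
Proof.
apply: (form_of_sqnorm (F := id) (G := fun _ v => v) (K := fun _ _ _ => 0)) => //.
- by move=> q v; exact: has_velocity_line.
- by move=> q u v; exact: has_velocity_cst.
- by move=> q u v; rewrite scaler0.
Qed.

(** Supplying the second derivative [K] explicitly avoids deducing from holomorphy that ['d F] is
    again differentiable. *)
Lemma kahler_immersion_sqnorm (R : realType) (V : normedModType R[i])
    (F : V -> ell2 R) (K : V -> V -> V -> ell2 R) :
  (forall p, differentiable F p) ->
  (forall q u v, has_velocity (fun t : R => 'd F (q + t%:C *: u) v) 0 (K q u v)) ->
  (forall q u v, K q ('i *: u) v = 'i *: K q u v) ->
  kahler_immersion (form_of_potential (fun q => `|F q| ^+ 2)) F.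
Proof.
move=> dF GK Ki; split; first exact: dF.
rewrite (@form_of_sqnorm _ _ F (fun q v => 'd F q v) K); last exact: Ki.
- by rewrite /pullback flat_formE.
- move=> q v; have q0 : q + 0%:C *: v = q by rewrite scale0r addr0.
  by rewrite -[X in 'd F X]q0; apply: has_velocity_comp => //; exact: has_velocity_line.
- exact: GK.
- by move=> q v; rewrite linearZ.
Qed.

(** * Density of finite sequences, and a criterion for fullness *)

Section Density.
Variable R : realType.

Lemma dense_basis (T : set (ell2 R)) (x : ell2 R) : linear_subspace T ->
  (forall v : ell2 R,
     (forall e : R, 0 < e -> exists2 w, T w & rnorm (w - v) < e) -> T v) ->
  (forall j, exists2 v : ell2 R, T v & forall k, v k = (k == j)%:R) -> T x.
Proof.
move=> [T0 Tlin] Tcl Tbase; apply: Tcl => e e0.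
(* Truncations of x are finite combinations of basis vectors, hence lie in T. *)
have trunc n : exists2 w : ell2 R, T w & forall k, w k = if (k < n)%N then x k else 0.
  elim: n => [|n [w Tw wE]]; first by exists 0 => // k.
  have [v Tv vE] := Tbase n; exists (x n *: v + w); first exact: Tlin.
  move=> k; rewrite -[LHS]/(x n * v k + w k) vE wE ltnS.
  by case: (ltngtP k n) => [_|_|->]; rewrite ?mulr0 ?add0r ?mulr1 ?addr0.
have sx := @cvg_sqnorm _ x.
(* The limit of the partial sums only inherits a weak inequality; the factor 1/2 makes the final
   bound strict. *)
have e2 : 0 < e ^+ 2 / 2 by rewrite divr_gt0 // exprn_gt0.
move/cvgrPdist_lt: sx => /(_ _ e2)[n _ /(_ n (leqnn n)) /= Hn].
have [w Tw wE] := trunc n; exists w => //.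
have Sn := ler_norm (sqnorm x - series (fun n => normc (x n) ^+ 2) n).
pose y : ell2 R := w - x; rewrite -/y.
have [_] : (y : nat -> complex1 R) \in @square_summable R /\ sqnorm y <= e ^+ 2 / 2.
  apply: sqnorm_le => N; rewrite (le_trans _ (le_trans Sn (ltW Hn))) //.
  have wxE k : y k = if (k < n)%N then 0 else - x k.
    rewrite -[LHS]/(w k - x k) wE; case: ifP => _; [exact: subrr|exact: sub0r].
  (* The head of x up to n and the tail from n to N fit together in the partial sum of x up to
     [maxn n N]. *)
  rewrite lerBrDr; apply: le_trans (le_sqnorm (maxn n N) (ell2_seqP x)).
  rewrite /series /=.
  have -> : \sum_(0 <= k < N) normc (y k) ^+ 2 =
      \sum_(0 <= k < N | (n <= k)%N) normc (x k) ^+ 2.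
    rewrite [RHS]big_mkcond; apply: eq_bigr => k _; rewrite wxE [(n <= k)%N]leqNgt.
    case: ifP => /= _; last by rewrite normcN.
    by rewrite -[X in X ^+ _]/(@normc R 0) normc0 expr0n.
  rewrite (big_nat_widen _ N (maxn n N)) ?leq_maxr //.
  rewrite (big_nat_widen _ n (maxn n N)) ?leq_maxl //.
  rewrite [leRHS](bigID (fun k => (k < n)%N)) /= addrC lerD2r.
  rewrite big_mkcond [leRHS]big_mkcond; apply: ler_sum => k _.
  by rewrite -leqNgt; case: (n <= k)%N; case: (k < N)%N => //=; exact: sqr_ge0.
rewrite -rnorm_sqr => H; rewrite -(ltr_sqr (x := rnorm _)) ?nnegrE ?rnorm_ge0 ?ltW //.
by rewrite (le_lt_trans H) // ltr_pdivrMr // ltr_pMr ?exprn_gt0 // ltr1n.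
Qed.

(** One point suffices: if the closed tangent space at F(x0) contains the basis, it is all of ell2,
    and F(x0) + T_F(x0) M, contained in M, is everything. *)
Lemma full_criterion (T : Type) (F : T -> ell2 R) (x0 : T) :
  (forall M, complex_submanifold M -> totally_geodesic M -> range F `<=` M ->
     forall j, exists2 v : ell2 R, tangent M (F x0) v & forall k, v k = (k == j)%:R) ->
  full F.
Proof.
move=> H M subM geoM MT FM; apply: MT; apply/seteqP; split=> // x _.
have Mp : M (F x0) by apply: FM; exists x0.
rewrite -[x](subrKC (F x0)); apply: tangent_sub => //.
apply: dense_basis; first exact: tangent_linear.
  by move=> v; exact: tangent_closed.
exact: H.
Qed.

End Density.

(** * The weighted power map into ell2 and its derivatives *)

Section PowerSeries.
Variable R : realType.
Implicit Types (z h : complex1 R) (m n k : nat).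

Lemma expR_series_ge (x : R) n : 0 <= x -> series (exp_coeff x) n <= expR x.
Proof.
move=> x0; apply: nondecreasing_cvgn_le; last exact: is_cvg_series_exp_coeff.
by apply/nondecreasing_series => k _ _; rewrite divr_ge0 // exprn_ge0.
Qed.

Lemma ell2_bound (x : nat -> complex1 R) (C r : R) : 0 <= C -> 0 <= r ->
  (forall k, normc (x k) <= C * (r ^+ k / Num.sqrt k`!%:R)) ->
  x \in @square_summable R /\ sqnorm x <= C ^+ 2 * expR (r ^+ 2).
Proof.
move=> C0 r0 xC; apply: sqnorm_le => n.
apply: (@le_trans _ _ (C ^+ 2 * series (exp_coeff (r ^+ 2)) n)); last first.
  by rewrite ler_wpM2l ?exprn_ge0 // expR_series_ge // exprn_ge0.
rewrite /series /= mulr_sumr; apply: ler_sum => k _.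
have -> : C ^+ 2 * ((r ^+ 2) ^+ k / k`!%:R) =
    (C * (r ^+ k / Num.sqrt k`!%:R)) ^+ 2.
  by rewrite !exprMn exprVn sqr_sqrtr // exprAC.
by rewrite ler_sqr ?nnegrE ?normc_ge0 // mulr_ge0 // divr_ge0 ?exprn_ge0.
Qed.

(** The falling factorial is m! times a binomial coefficient, itself at most 2^k. This 2^k cancels
    the one in [fock_coeff], so all derivatives share the majorant with weight 1 / sqrt(k!). *)
Lemma falling_le k m : (k ^_ m <= m`! * 2 ^ k)%N.
Proof.
rewrite -bin_ffact mulnC leq_mul //; suff : ('C(k, m) <= (1 + 1) ^ k)%N by [].
have [mk|km] := leqP m k; last by rewrite bin_small.
by rewrite expnDn (bigD1 (Ordinal (n := k.+1) (m := m) mk)) //= !exp1n !muln1 leq_addr.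
Qed.

(** Bargmann-Fock weights: their squares 1 / (4^k k!) are the Taylor coefficients of t |-> exp(t /
    4). *)
Definition fock_coeff (k : nat) : R := (2 ^+ k * Num.sqrt k`!%:R)^-1.

(* The m-th derivative of z |-> (z^k / (2^k sqrt (k!)))_k. *)
Definition fock_seq m z : nat -> complex1 R :=
  fun k => (fock_coeff k * (k ^_ m)%:R)%:C * z ^+ (k - m).

Lemma normc_real (r : R) : normc r%:C = `|r|.
Proof. by rewrite /= expr0n addr0 sqrtr_sqr. Qed.

Lemma normcX (z : R[i]) n : normc (z ^+ n) = normc z ^+ n.
Proof. by elim: n => [|n ih]; rewrite ?expr0 ?normc1 // !exprS normcM ih. Qed.

Lemma fock_coeff_le k m : fock_coeff k * (k ^_ m)%:R <= m`!%:R / Num.sqrt k`!%:R.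
Proof.
have s0 : 0 < Num.sqrt k`!%:R :> R by rewrite sqrtr_gt0 ltr0n fact_gt0.
have t0 : 0 < 2 ^+ k :> R by rewrite exprn_gt0.
rewrite /fock_coeff invfM -mulrA mulrCA mulrC ler_pM2r ?invr_gt0 //.
by rewrite mulrC ler_pdivrMr // -natrX -natrM ler_nat falling_le.
Qed.

Lemma fock_coeff_ge0 k m : 0 <= fock_coeff k * (k ^_ m)%:R.
Proof. by rewrite mulr_ge0 // invr_ge0 mulr_ge0 ?exprn_ge0 ?sqrtr_ge0. Qed.

(** Since r >= 1, the exponent k - m may be raised to k. The factor B is 1 for square summability
    and |h|^2 for the remainder. *)
Lemma fock_bound m k (y : R[i]) (B r : R) : 1 <= r -> 0 <= B ->
  normc y <= B * r ^+ (k - m) ->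
  normc ((fock_coeff k * (k ^_ m)%:R)%:C * y) <=
    m`!%:R * B * (r ^+ k / Num.sqrt k`!%:R).
Proof.
move=> r1 B0 yB; rewrite normcM normc_real ger0_norm ?fock_coeff_ge0 //.
have r0 : 0 <= r by rewrite (le_trans ler01).
apply: le_trans (ler_pM (fock_coeff_ge0 _ _) (normc_ge0 _) (fock_coeff_le _ _) yB) _.
have -> : m`!%:R / Num.sqrt k`!%:R * (B * r ^+ (k - m)) =
  m`!%:R * B / Num.sqrt k`!%:R * r ^+ (k - m) by ring.
have -> : m`!%:R * B * (r ^+ k / Num.sqrt k`!%:R) =
  m`!%:R * B / Num.sqrt k`!%:R * r ^+ k by ring.
apply: ler_wpM2l; first by rewrite divr_ge0 ?sqrtr_ge0 // mulr_ge0.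
by rewrite ler_weXn2l // leq_subr.
Qed.

Lemma fock_seqP m z : fock_seq m z \in @square_summable R.
Proof.
have r1 : 1 <= normc z + 1 by rewrite lerDr normc_ge0.
have [] // := @ell2_bound (fock_seq m z) (m`!%:R * 1) (normc z + 1).
- by rewrite addr_ge0 // normc_ge0.
- move=> k; apply: fock_bound => //; rewrite mul1r normcX.
  by rewrite lerXn2r ?nnegrE ?addr_ge0 ?normc_ge0 // lerDl.
Qed.

Definition fock m z : ell2 R := Ell2 (fock_seqP m z).

Lemma bernoulli_derivative (x : R) n : 0 <= x -> n%:R * x ^+ n.-1 <= (x + 1) ^+ n.
Proof.
move=> x0; elim: n => [|n ih]; first by rewrite mul0r.
have xn : x ^+ n <= (x + 1) ^+ n by rewrite lerXn2r ?nnegrE ?addr_ge0 // lerDl.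
have -> : n.+1%:R * x ^+ n.+1.-1 = x * (n%:R * x ^+ n.-1) + x ^+ n.
  case: n {ih xn} => [|n]; first by rewrite mul0r mulr0 add0r mul1r.
  by rewrite /= [RHS]addrC -natr1 mulrDl mul1r addrC mulrCA -exprS.
by rewrite exprS mulrDl mul1r lerD // ler_wpM2l.
Qed.

(** The remainders satisfy rem_(n+1) = (z + h) rem_n + n h^2 z^(n-1). With |z + h| <= |z| + 1 and n
    |z|^(n-1) <= (|z| + 2)^n, the base |z| + 2 is what closes the induction. *)
Lemma pow_remainder (z h : R[i]) n : normc h <= 1 ->
  normc ((z + h) ^+ n - z ^+ n - n%:R * h * z ^+ n.-1) <=
    normc h ^+ 2 * (normc z + 2) ^+ n.
Proof.
move=> h1; elim: n => [|n ih].
  rewrite !expr0 subrr !mul0r subrr -[X in X <= _]/(normc (0 : R[i])) normc0.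
  by rewrite mulr1 sqr_ge0.
set rem := _ - _ - _ in ih.
have -> : (z + h) ^+ n.+1 - z ^+ n.+1 - n.+1%:R * h * z ^+ n.+1.-1 =
    (z + h) * rem + h ^+ 2 * (n%:R * z ^+ n.-1).
  rewrite /rem; case: n {ih rem} => [|n] /=; first by ring.
  by rewrite !exprS -[n.+2%:R]natr1; ring.
have z0 := normc_ge0 z; have h0 := normc_ge0 h.
apply: le_trans (le_normcD _ _) _; rewrite !normcM normcX.
have zh : normc (z + h) <= normc z + 1.
  by apply: le_trans (le_normcD _ _) _; rewrite lerD2l.
have -> : normc (n%:R : R[i]) = n%:R.
  by rewrite -(rmorph_nat (real_complex R)) normc_real normr_nat.
rewrite -[normc h * normc h]expr2.
have B : n%:R * normc z ^+ n.-1 <= (normc z + 2) ^+ n.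
  apply: le_trans (bernoulli_derivative _ z0) _.
  by rewrite lerXn2r ?nnegrE ?addr_ge0 // lerD2l ler1n.
apply: (@le_trans _ _ ((normc z + 1) * (normc h ^+ 2 * (normc z + 2) ^+ n) +
   normc h ^+ 2 * (normc z + 2) ^+ n)).
  apply: lerD; first by rewrite ler_pM ?normc_ge0.
  by apply: ler_wpM2l => //; exact: sqr_ge0.
by rewrite le_eqVlt; apply/orP; left; apply/eqP; rewrite [_ ^+ n.+1]exprS; ring.
Qed.

Lemma fock_remainder m z h : normc h <= 1 ->
  rnorm (fock m (z + h) - fock m z - h *: fock m.+1 z) <=
    Num.sqrt (m`!%:R ^+ 2 * expR ((normc z + 2) ^+ 2)) * normc h ^+ 2.
Proof.
move=> h1; have z0 := normc_ge0 z; have h0 := normc_ge0 h.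
rewrite -(ler_sqr (x := rnorm _)) ?nnegrE ?rnorm_ge0 ?mulr_ge0 ?sqrtr_ge0 ?exprn_ge0 //.
rewrite rnorm_sqr exprMn sqr_sqrtr ?mulr_ge0 ?expR_ge0 ?sqr_ge0 //.
rewrite mulrAC -exprMn.
apply: (ell2_bound _ _ _).2; rewrite ?mulr_ge0 ?addr_ge0 ?sqr_ge0 // => k.
have -> : (fock m (z + h) - fock m z - h *: fock m.+1 z) k =
   (fock_coeff k * (k ^_ m)%:R)%:C *
     ((z + h) ^+ (k - m) - z ^+ (k - m) - (k - m)%:R * h * z ^+ (k - m).-1).
  rewrite -[LHS]/(fock_seq m (z + h) k - fock_seq m z k - h * fock_seq m.+1 z k).
  (* The falling factorial of order m + 1 is the one of order m times k - m, so each coordinate is a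
     weight times the remainder of the power k - m. *)
  rewrite /fock_seq ffactnSr subnS natrM !rmorphM /= rmorph_nat.
  rewrite (rmorph_nat (real_complex R) (k - m)).
  set A := (_ + _) ^+ _; set B := z ^+ _; set D := z ^+ _.
  ring.
apply: fock_bound; rewrite ?sqr_ge0 //; last exact: pow_remainder.
by rewrite ler_wpDl // ler1n.
Qed.

End PowerSeries.

Lemma differentiable1 (R : realType) (W : normedModType R[i]) (f : complex1 R -> W)
    (z : complex1 R) (a : W) :
  (forall e : R, 0 < e -> exists2 d : R, 0 < d & forall h, normc h < d ->
     rnorm (f (z + h) - f z - h *: a) <= e * normc h) ->
  differentiable f z /\ forall h, 'd f z h = h *: a.
Proof.
move=> H.
have D : (fun h : complex1 R => h^-1 *: ((f \o shift z) (h *: (1 : complex1 R)) - f z))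
    @ (0 : complex1 R)^' --> a.
  apply/cvgrPdist_le => -[e e'] e0.
  have [er ->] : 0 < e /\ e' = 0 by move: e0; rewrite ltcE /= => /andP[/eqP].
  have [d d0 {}H] := H _ er; rewrite near_withinE.
  apply: (@nbhs_rnormP R (complex1 R) 0 _).2; exists d => // h.
  rewrite subr0 rnorm_complex => hd h0.
  have hn : 0 < normc h.
    by rewrite lt_def normc_ge0 andbT; apply: contra h0 => /eqP/eq0_normc ->.
  rewrite rnormE lecR /= [h *: _]mulr1 [h + z]addrC -rnormN opprB.
  have -> : h^-1 *: (f (z + h) - f z) - a = h^-1 *: (f (z + h) - f z - h *: a).
    by rewrite [RHS]scalerBr scalerA mulVf // scale1r.
  by rewrite rnormZ normcV ler_pdivrMl // mulrC; exact: H.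
have df : derivable f z 1 by apply/cvg_ex; exists a.
have dff : differentiable f z by apply/derivable1_diffP.
split=> // h; have -> : h = h *: (1 : complex1 R) by rewrite [RHS]mulr1.
rewrite linearZ -deriveE //= [h *: _ in RHS]mulr1; congr (_ *: _).
exact: cvg_lim D.
Qed.

Lemma differentiable_fock (R : realType) m (z : complex1 R) :
  differentiable (fock m) z /\ forall h, 'd (fock m) z h = h *: fock m.+1 z.
Proof.
apply: differentiable1 => e e0.
set C := Num.sqrt (m`!%:R ^+ 2 * expR ((normc z + 2) ^+ 2)) + 1.
have C0 : 0 < C by rewrite ltr_wpDl // sqrtr_ge0.
exists (Num.min 1 (e / C)); first by rewrite lt_min ltr01 divr_gt0.
move=> h; rewrite lt_min => /andP[h1 he].
apply: le_trans (fock_remainder _ _ (ltW h1)) _.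
rewrite expr2 mulrA ler_wpM2r ?normc_ge0 //.
apply: (@le_trans _ _ (C * normc h)); first by rewrite ler_wpM2r ?normc_ge0 // lerDl.
by rewrite mulrC -ler_pdivlMr // ltW.
Qed.

(** * The complex exponential and the factor depending on w *)

Section ComplexExponential.
Variable R : realType.

Lemma is_derive_rnorm (f : R -> R) (x df : R) : is_derive x 1 f df ->
  forall e : R, 0 < e -> exists2 d : R, 0 < d &
    forall h, `|h| < d -> `|f (x + h) - f x - h * df| <= e * `|h|.
Proof.
move=> [fx <-] e e0.
have /cvgrPdist_le /(_ _ e0) /nbhs_normP[d /= d0 H] := fx.
exists d => // h hd; have [->|h0] := eqVneq h 0.
  by rewrite addr0 subrr mul0r subr0 normr0 mulr0.
have hb : ball_ Num.norm 0 d h by rewrite /ball_ /= sub0r normrN.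
set D := 'D_1 f x; have H' : `|D - h^-1 * (f (x + h) - f x)| <= e.
  by have /= := H h hb h0; rewrite [h *: _]mulr1 [h + x]addrC.
have -> : f (x + h) - f x - h * D = - (h * (D - h^-1 * (f (x + h) - f x))) by field.
by rewrite normrN normrM mulrC ler_wpM2r.
Qed.

Lemma normc_le (z : R[i]) : normc z <= `|complex.Re z| + `|complex.Im z|.
Proof.
rewrite -(ler_sqr (x := normc _)) ?nnegrE ?normc_ge0 ?addr_ge0 // normc_sqr.
rewrite -(real_normK (num_real (complex.Re z))) -(real_normK (num_real (complex.Im z))).
have := normr_ge0 (complex.Re z); have := normr_ge0 (complex.Im z); nra.
Qed.

Lemma Re_le_normc (z : R[i]) : `|complex.Re z| <= normc z.
Proof.
rewrite -(ler_sqr (x := `|_|)) ?nnegrE ?normc_ge0 // normc_sqr real_normK ?num_real //.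
by rewrite lerDl sqr_ge0.
Qed.

Lemma Im_le_normc (z : R[i]) : `|complex.Im z| <= normc z.
Proof.
rewrite -(ler_sqr (x := `|_|)) ?nnegrE ?normc_ge0 // normc_sqr real_normK ?num_real //.
by rewrite lerDr sqr_ge0.
Qed.

Lemma cexpD (a b : R[i]) : cexp (a + b) = cexp a * cexp b.
Proof.
case: a b => a1 a2 [b1 b2]; rewrite /cexp /= expRD cosD sinD.
by congr (_ +i* _) => /=; ring.
Qed.

Lemma normc_cexp (z : R[i]) : normc (cexp z) = expR (complex.Re z).
Proof.
rewrite /cexp normcM normc_real ger0_norm ?expR_ge0 // /normc.
by rewrite cos2Dsin2 sqrtr1 mulr1.
Qed.

Lemma cexp_remainder (e : R) : 0 < e -> exists2 d : R, 0 < d &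
  forall h : R[i], normc h < d -> normc (cexp h - 1 - h) <= e * normc h.
Proof.
(* The 9 is 4 + 5, from the bounds 4 a |h| and 5 a |h| on the real and imaginary parts; the latter
   uses |h| < a for the quadratic term (E - 1) y. *)
move=> e0; pose a := Num.min 1 (e / 9).
have a0 : 0 < a by rewrite lt_min ltr01 divr_gt0.
have a1 : a <= 1 by rewrite ge_min lexx.
have ae : 9 * a <= e by rewrite mulrC -ler_pdivlMr // ge_min lexx orbT.
clearbody a.
have [d1 d10 H1] := is_derive_rnorm (is_derive_expR (0 : R)) a0.
have [d2 d20 H2] := is_derive_rnorm (is_derive_cos (0 : R)) a0.
have [d3 d30 H3] := is_derive_rnorm (is_derive_sin (0 : R)) a0.
exists (Num.min a (Num.min d1 (Num.min d2 d3))); first by rewrite !lt_min a0 d10 d20.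
move=> h; rewrite !lt_min => /and4P[ha hd1 hd2 hd3].
move: (Re_le_normc h) (Im_le_normc h) (normc_ge0 h) ha hd1 hd2 hd3.
move: (normc h) => n xn yn n0 na n1 n2 n3.
have := H1 _ (le_lt_trans xn n1); have := H2 _ (le_lt_trans yn n2).
have := H3 _ (le_lt_trans yn n3); rewrite !add0r expR0 cos0 sin0.
rewrite oppr0 mulr0 !subr0 !mulr1 => Hs Hc HE.
apply: le_trans (normc_le _) _.
case: h xn yn Hs Hc HE => x y /= xn yn; rewrite !mul0r !subr0 addr0.
set E := expR x; set c := cos y; set s := sin y => Hs Hc HE.
have x0 := normr_ge0 x; have y0 := normr_ge0 y.
have HE1 : `|E - 1| <= 2 * n.
  have -> : E - 1 = (E - 1 - x) + x by ring.
  by apply: le_trans (ler_normD _ _) _; nra.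
have E3 : `|E| <= 3.
  have -> : E = (E - 1) + 1 by ring.
  apply: le_trans (ler_normD _ _) _; rewrite normr1; lra.
have HR : `|E * c - 1 - x| <= 4 * a * n.
  have -> : E * c - 1 - x = (E - 1 - x) + E * (c - 1) by ring.
  apply: le_trans (ler_normD _ _) _; rewrite normrM.
  have := ler_pM (normr_ge0 _) (normr_ge0 _) E3 Hc; nra.
have HI : `|E * s - y| <= 5 * a * n.
  have -> : E * s - y = E * (s - y) + (E - 1) * y by ring.
  apply: le_trans (ler_normD _ _) _; rewrite !normrM.
  have := ler_pM (normr_ge0 _) (normr_ge0 _) E3 Hs.
  have := ler_pM (normr_ge0 _) (normr_ge0 _) HE1 yn; nra.
apply: (@le_trans _ _ (4 * a * n + 5 * a * n)); last by nra.
by apply: lerD; rewrite ?addr0.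
Qed.

Definition wave (w : complex1 R) : complex1 R := cexp (- ('i / 4) * w).

Lemma wave0 : wave 0 = 1.
Proof.
by rewrite /wave mulr0 /cexp /= expR0 cos0 sin0; congr (_ +i* _); ring.
Qed.

(** The functional equation of the exponential factors out [wave w] and reduces the remainder to the
    one at 0. *)
Lemma differentiable_wave (w : complex1 R) :
  differentiable wave w /\ forall h, 'd wave w h = h *: (- ('i / 4) * wave w : complex1 R).
Proof.
set c : R[i] := - ('i / 4).
apply: differentiable1 => e e0.
set K := normc (wave w) * normc c + 1.
have K0 : 0 < K by rewrite ltr_wpDl // mulr_ge0 ?normc_ge0.
have c1 : 0 < normc c + 1 by rewrite ltr_wpDl ?normc_ge0.
have [d d0 H] := cexp_remainder (divr_gt0 e0 K0).
exists (d / (normc c + 1)); first by rewrite divr_gt0.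
move=> h hd; rewrite rnorm_complex.
have chd : normc (c * h) < d.
  rewrite normcM; have := hd; rewrite ltr_pdivlMr // mulrC; apply: le_lt_trans.
  by rewrite ler_wpM2r ?normc_ge0 // lerDl.
have -> : wave (w + h) - wave w - h *: (c * wave w : complex1 R) =
    wave w * (cexp (c * h) - 1 - c * h).
  by rewrite /wave mulrDr cexpD -[h *: _]/(h * _) -/c; ring.
rewrite normcM; have := H _ chd; rewrite normcM => Hc.
apply: le_trans (ler_wpM2l (normc_ge0 _) Hc) _.
rewrite (_ : normc (wave w) * (e / K * (normc c * normc h)) =
  e * normc h * ((normc (wave w) * normc c) / K)); last by ring.
rewrite ler_piMr ?mulr_ge0 ?normc_ge0 ?(ltW e0) //.
by rewrite ler_pdivrMr // mul1r lerDl.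
Qed.

End ComplexExponential.

(** * Differentiability of a scalar function times a vector function *)

Section ScaleBilinear.
Variables (K : numFieldType) (V : normedModType K).

Definition scale_pair (a : K^o) (v : V) : V := a *: v.

Lemma scale_pair_is_bilinear :
  bilinear_for (GRing.Scale.Law.clone _ _ *:%R _) (GRing.Scale.Law.clone _ _ *:%R _)
    scale_pair.
Proof.
split=> [u'|u] a x y; rewrite /scale_pair /=.
  by rewrite scalerDl scalerA.
by rewrite scalerDr !scalerA mulrC.
Qed.

HB.instance Definition _ := bilinear_isBilinear.Build K K^o V V _ _ scale_pair
  scale_pair_is_bilinear.

Lemma differentiable_scale (U : normedModType K) (f : U -> K^o) (g : U -> V) x :
  differentiable f x -> differentiable g x ->
  differentiable (fun y => f y *: g y) x.
Proof.
move=> df dg.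
have -> : (fun y => f y *: g y) =
    (fun p : K^o * V => scale_pair p.1 p.2) \o (fun y => (f y, g y)) by [].
apply: differentiable_comp; first exact: differentiable_pair.
by apply: differentiable_bilin => p; exact: scale_continuous.
Qed.

End ScaleBilinear.

(** * The immersion: potential, pullback and fullness *)

Section Immersion.
Variable R : realType.
Implicit Types (q u v : complex2 R).

Definition immersion q : ell2 R := wave q.2 *: fock 0 q.1.

Definition immersion_diff q v : ell2 R :=
  (v.2 *: (- ('i / 4) * wave q.2 : complex1 R)) *: fock 0 q.1 +
  wave q.2 *: (v.1 *: fock 1 q.1).

Lemma has_velocity_fock m (c : R -> complex1 R) t (v : complex1 R) : has_velocity c t v ->
  has_velocity (fun s => fock m (c s)) t (v *: fock m.+1 (c t)).
Proof.
have [df <-] := differentiable_fock m (c t); exact: has_velocity_comp.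
Qed.

Lemma has_velocity_wave (c : R -> complex1 R) t (v : complex1 R) : has_velocity c t v ->
  has_velocity (fun s => wave (c s)) t (v *: (- ('i / 4) * wave (c t) : complex1 R)).
Proof.
have [df <-] := differentiable_wave (c t); exact: has_velocity_comp.
Qed.

Lemma differentiable_immersion q : differentiable immersion q.
Proof.
apply: differentiable_scale.
- apply: (@differentiable_comp _ _ _ _ snd (@wave R)).
    by apply: linear_differentiable => p; exact: cvg_snd.
  by have [] := differentiable_wave q.2.
- apply: (@differentiable_comp _ _ _ _ fst (@fock R 0)).
    by apply: linear_differentiable => p; exact: cvg_fst.
  by have [] := differentiable_fock 0 q.1.
Qed.

Lemma has_velocity_immersion q v :
  has_velocity (fun t : R => immersion (q + t%:C *: v)) 0 (immersion_diff q v).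
Proof.
have l1 := has_velocity_line q.1 v.1 0; have l2 := has_velocity_line q.2 v.2 0.
have := has_velocity_scale (has_velocity_wave l2) (has_velocity_fock (m := 0%N) l1).
by rewrite !scale0r !addr0.
Qed.

(** Both sides are velocities of the same curve, so no differential of a product has to be
    composed. *)
Lemma diff_immersion q v : 'd immersion q v = immersion_diff q v.
Proof.
have q0 : q + 0%:C *: v = q by rewrite scale0r addr0.
have H : has_velocity (fun t : R => immersion (q + t%:C *: v)) 0 ('d immersion q v).
  rewrite -[X in 'd immersion X]q0; apply: has_velocity_comp.
    exact: differentiable_immersion.
  exact: has_velocity_line.
exact: has_velocity_unique H (@has_velocity_immersion q v).
Qed.

Lemma sqnorm_fock0 (z : complex1 R) : sqnorm (fock 0 z) = expR (normc z ^+ 2 / 4).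
Proof.
congr (limn (series _)); apply/funext => k; rewrite /= /fock_seq ffactn0 mulr1 subn0.
rewrite normcM normcX normc_real exprMn real_normK ?num_real //.
have E4 : (2 ^+ k) ^+ 2 = 4 ^+ k :> R by rewrite exprAC; congr (_ ^+ _); ring.
rewrite /exp_coeff /= expr_div_n exprAC /fock_coeff exprVn exprMn E4 sqr_sqrtr // invfM.
by rewrite mulrC mulrA.
Qed.

(** The exponent of Phi is real, since -(i/4)(w - conj w) = Im(w) / 2; this matches the square of
    |[wave w]| = exp(Im(w) / 4). *)
Lemma Phi_immersion : @Phi R = fun q => `|immersion q| ^+ 2.
Proof.
apply/funext => -[z w].
have four : 4^-1 = (4^-1)%:C :> R[i] by rewrite fmorphV rmorph_nat.
have E2 : normc (wave w) = expR (complex.Im w / 4).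
  rewrite normc_cexp four -complexiE; congr expR; case: w => x y /=; ring.
have E1 : 4^-1 * (rnorm (z : complex1 R))%:C ^+ 2 - 'i / 4 * (w - w^*) =
    (normc z ^+ 2 / 4 + complex.Im w / 2)%:C :> R[i].
  rewrite rnorm_complex four -complexiE -rmorphXn -rmorphM; case: w {E2} => x y.
  by congr (_ +i* _) => /=; field.
rewrite rnormE /immersion rnormZ -[(z, w).2]/w -[(z, w).1]/z E2 -rmorphXn.
rewrite [_ ^+ 2]exprMn rnorm_sqr sqnorm_fock0 /Phi rnormE E1 /cexp /= cos0 sin0.
have -> : 1 +i* 0 = 1 :> R[i] by [].
rewrite mulr1 -expRM_natl -expRD; congr ((expR _)%:C).
by field.
Qed.

Lemma kahler_immersion_immersion :
  kahler_immersion (form_of_potential (@Phi R)) immersion.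
Proof.
rewrite Phi_immersion.
pose c : R[i] := - ('i / 4).
(* The second derivative in the directions u and v, each line pair being the product rule applied to
   one summand of [immersion_diff]. *)
pose K q u v : ell2 R :=
  ((v.2 * (c * (u.2 * (c * wave q.2)))) *: fock 0 q.1 +
   (v.2 * (c * wave q.2)) *: (u.1 *: fock 1 q.1)) +
  ((u.2 * (c * wave q.2)) *: (v.1 *: fock 1 q.1) +
   wave q.2 *: (v.1 *: (u.1 *: fock 2 q.1))).
apply: (kahler_immersion_sqnorm (K := K)).
- exact: differentiable_immersion.
- move=> q u v; under [fun t => _]eq_fun do rewrite diff_immersion.
  have l1 := has_velocity_line q.1 u.1 0; have l2 := has_velocity_line q.2 u.2 0.
  have w2 := has_velocity_wave l2.
  have f0 := has_velocity_fock (m := 0%N) l1; have f1 := has_velocity_fock (m := 1%N) l1.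
  have := has_velocityD
    (has_velocity_scale (has_velocityZ (a := v.2) (has_velocityZ (a := c) w2)) f0)
    (has_velocity_scale w2 (has_velocityZ (a := v.1) f1)).
  by rewrite !scale0r !addr0.
- move=> q u v; rewrite /K !scalerDr !scalerA /=.
  by congr (_ *: _ + _ *: _ + (_ *: _ + _ *: _)); rewrite -![_ *: _]/(_ * _); ring.
Qed.

Lemma full_immersion : full immersion.
Proof.
pose f k (t : R) : ell2 R := fock k t%:C.
have f0 t : f 0 t = immersion (t%:C, 0) by rewrite /immersion wave0 scale1r.
(* For j > k the power of 0 vanishes; for j < k the truncated exponent is 0 and the falling
   factorial vanishes instead. *)
have fE k j : f k 0 j = (fock_coeff R k * k`!%:R)%:C *: (j == k)%:R.
  rewrite -[LHS]/((fock_coeff R j * (j ^_ k)%:R)%:C * 0%:C ^+ (j - k)).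
  have [->|jk] := eqVneq j k; first by rewrite subnn expr0 ffactnn.
  rewrite scaler0; case: (ltngtP j k) jk => // jk _.
    by rewrite ffact_small // mulr0 mul0r.
  by rewrite expr0n subn_eq0 leqNgt jk mulr0.
have idv t : has_velocity (fun s : R => s%:C : complex1 R) t 1.
  have := has_velocity_line (0 : complex1 R) 1 t.
  by congr (has_velocity _ _ _); apply/funext => s; rewrite add0r [_ *: _]mulr1.
apply: (full_criterion (x0 := (0, 0))) => M subM geoM FM j.
have Mp : M (f 0 0) by rewrite f0; apply: FM; exists (0%:C, 0).
have coeff0 k : (fock_coeff R k * k`!%:R)%:C != 0.
  have s0 : 0 < fock_coeff R k.
    by rewrite invr_gt0 mulr_gt0 ?exprn_gt0 // sqrtr_gt0 ltr0n fact_gt0.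
  have : fock_coeff R k * k`!%:R != 0.
    by rewrite mulf_neq0 ?gt_eqF // ltr0n fact_gt0.
  by apply: contra => /eqP[/eqP].
suff [a a0 Ta] : exists2 a : R[i], a != 0 & tangent M (f 0 0) (a *: f j 0).
  exists ((a * (fock_coeff R j * j`!%:R)%:C)^-1 *: (a *: f j 0)).
    by rewrite -[immersion (0, 0)]f0; exact: tangentZ.
  move=> k; rewrite -[LHS]/(_ * (a * f j 0 k)) fE.
  by rewrite -[_ *: _]/(_ * _) [a * (_ * _)]mulrA mulKf // mulf_neq0.
(* For j = 0 the curve is the w-axis, whose velocity is -(i/4) F(0, 0); for larger indices it is the
   z-axis, with iterated derivatives. *)
case: j => [|j].
  exists (- ('i / 4)).
    by rewrite oppr_eq0 mulf_neq0 ?neq0Ci // invr_eq0 pnatr_eq0.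
  exists (fun s : R => immersion (0, s%:C)); split.
  - by rewrite f0.
  - by apply/nbhs_normP; exists 1 => //= s _; apply: FM; exists (0, s%:C).
  - have := has_velocity_scale (has_velocity_wave (idv 0)) (has_velocity_cst (f 0 0) 0).
    by rewrite scaler0 addr0 wave0 mulr1 scale1r.
exists 1; first exact: oner_neq0.
rewrite scale1r; apply: tangent_derivatives => //.
- move=> k t; have := has_velocity_fock (m := k) (idv t); by rewrite scale1r.
- by move=> t; rewrite f0; apply: FM; exists (t%:C, 0).
Qed.

End Immersion.

Theorem proposition4p6 (R : realType) :
  exists F : complex2 R -> ell2 R,
    kahler_immersion (form_of_potential (@Phi R)) F /\ full F.
Proof.
by exists (@immersion R); split; [exact: kahler_immersion_immersion|exact: full_immersion].
Qed.
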